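(* Let $B_4$ be the fourth weak Bruhat graph. Then $\pi(B_4)\le 66$.
   Context: The fourth weak Bruhat graph $B_4$ is the graph whose $24$ vertices are the permutations of $\{1,2,3,4\}$ (the elements of the symmetric group $S_4$), in which two permutations are adjacent exactly when one covers the other in the weak Bruhat order, i.e. when one is obtained from the other by swapping two adjacent entries (composing with an adjacent transposition $(i\ i{+}1)$, $i\in\{1,2,3\}$); equivalently, the Cayley graph of $S_4$ with generators $(1\,2),(2\,3),(3\,4)$. A configuration on a graph $G$ is a function $C:V(G)\to\mathbb{N}$, with size $|C|=\sum_v C(v)$. A pebbling move along an edge $uv$ is allowed when $C(u)\ge 2$; it removes two pebbles from $u$ and adds one pebble to $v$. For a root vertex $r$, $C$ is $r$-solvable if some sequence of pebbling moves yields at least one pebble on $r$. $\pi(G,r)$ is the smallest $t$ such that every configuration of size $t$ is $r$-solvable, and the pebbling number is $\pi(G)=\max_{r\in V(G)}\pi(G,r)$. *)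

(* Defs.v *)
From mathcomp Require Import all_boot all_fingroup.

Set Implicit Arguments.
Unset Strict Implicit.
Unset Printing Implicit Defensive.

(* [p : 'S_n] is read in one-line notation p(0) p(1) ... p(n-1). As
   (s * p)%g x = p (s x), the product [tperm i j * p] swaps the entries of [p]
   in positions [i] and [j]. *)
Definition weak_bruhat (n : nat) : rel 'S_n := fun p q =>
  [exists i : 'I_n, exists j : 'I_n,
    (j == i.+1 :> nat) && (q == (tperm i j * p)%g)].

Definition B4 : rel 'S_4 := @weak_bruhat 4.

Section Pebbling.
Variables (V : finType) (e : rel V).

Definition config := {ffun V -> nat}.

Definition config_size (C : config) : nat := \sum_v C v.

Definition move (C : config) (u v : V) : config :=
  [ffun w => C w - 2 * (w == u) + (w == v)].

Definition pebbling_step : rel config := fun C D =>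
  [exists u, exists v, [&& e u v, 2 <= C u & D == move C u v]].

Definition root_solvable (r : V) (C : config) : Prop :=
  exists2 s : seq config, path pebbling_step C s & 0 < last C s r.

Definition every_config_solvable (r : V) (t : nat) : Prop :=
  forall C : config, config_size C = t -> root_solvable r C.

(* The numbers pi(G, r) and pi(G) exist only for connected graphs, so they are
   given by their graphs: [is_pebbling_number k] means "pi(G) exists and equals
   k". *)
Definition is_rooted_pebbling_number (r : V) (t : nat) : Prop :=
  every_config_solvable r t /\ forall t', every_config_solvable r t' -> t <= t'.

Definition is_pebbling_number (k : nat) : Prop :=
  exists2 f : V -> nat,
    forall r, is_rooted_pebbling_number r (f r) & k = \max_r f r.

Lemma is_rooted_pebbling_number_unique r t t' :
  is_rooted_pebbling_number r t -> is_rooted_pebbling_number r t' -> t = t'.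
Proof.
by move=> [St mint] [St' mint']; apply/eqP; rewrite eqn_leq mint // mint'.
Qed.

Lemma is_pebbling_number_unique k k' :
  is_pebbling_number k -> is_pebbling_number k' -> k = k'.
Proof.
move=> [f fP ->] [g gP ->]; apply: eq_bigr => r _.
exact: is_rooted_pebbling_number_unique (fP r) (gP r).
Qed.

End Pebbling.

Lemma weak_bruhat_sym n : symmetric (@weak_bruhat n).
Proof.
suff imp p q : @weak_bruhat n p q -> weak_bruhat q p.
  by move=> p q; apply/idP/idP; apply: imp.
case/existsP=> i /existsP[j /andP[ij /eqP->]].
apply/existsP; exists i; apply/existsP; exists j.
by rewrite ij /= mulgA tperm2 mul1g.
Qed.

Lemma weak_bruhat_irr n : irreflexive (@weak_bruhat n).
Proof.
move=> p; apply/negbTE/negP.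
move=> /existsP[i /existsP[j /andP[/eqP ij /eqP pE]]].
have /permP/(_ i) : tperm i j = 1%g by apply: (mulIg p); rewrite mul1g -pE.
rewrite tpermL perm1 => ji; move: ij; rewrite ji => /eqP.
by rewrite ltn_eqF.
Qed.

(* Main.v *)
Require Import Defs.
From Stdlib Require Import Classical_Prop.
From mathcomp Require Import all_boot all_fingroup.

Set Implicit Arguments.
Unset Strict Implicit.
Unset Printing Implicit Defensive.

(** Hurlbert's weight function method. Let [w] be a weight on the vertices such
    that every vertex [v] of positive weight is adjacent to the root or to a
    vertex of weight at least [2 * w v]. Moving two pebbles from [v] to that
    neighbour does not lower the total weight of the configuration, and this is
    possible as long as some vertex of positive weight holds two pebbles. So a
    configuration that weighs more than the all-ones configuration reaches the
    root. In [B4] six such weights, built on geodesics from the root to its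
    antipode with a few extra branches near the antipode, sum to at least 8 at
    each vertex other than the root, and to 520 = 8 * 65 in total: hence any 66
    pebbles outweigh the all-ones configuration for one of the six. *)

(** * Weight functions and pebbling moves *)

Section WeightFunctions.
Variables (V : finType) (e : rel V) (r : V).
Implicit Types (C : config V) (w : V -> nat).

Definition weight w C : nat := \sum_v C v * w v.

Definition weight_strategy w : Prop :=
  forall v, 0 < w v -> exists2 u, e v u & (u == r) || (2 * w v <= w u).

Lemma weight1 C : weight (fun=> 1) C = config_size C.
Proof. by apply: eq_bigr => v _; rewrite muln1. Qed.

Lemma sum_mem_weight w u : \sum_v (v == u) * w v = w u.
Proof.
rewrite (bigD1 u) //= eqxx mul1n big1 ?addn0 // => v /negbTE->.
by rewrite mul0n.
Qed.

(** The loss [2 * w u] stands on the left to avoid truncated subtraction. *)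
Lemma weight_move w C u v :
  2 <= C u -> weight w (move C u v) + 2 * w u = weight w C + w v.
Proof.
move=> Cu; rewrite -(sum_mem_weight w u) -(sum_mem_weight w v).
rewrite big_distrr -!big_split /=; apply: eq_bigr => x _; rewrite ffunE.
case: (altP (x =P u)) => [->|_] /=; last by rewrite muln0 subn0 mulnDl addn0.
by rewrite mul1n muln1 -!mulnDl addnAC subnK.
Qed.

Lemma root_solvable_pebbled C : 0 < C r -> root_solvable e r C.
Proof. by move=> Cr; exists [::]. Qed.

Lemma root_solvable_move C u v :
  e u v -> 2 <= C u -> root_solvable e r (move C u v) -> root_solvable e r C.
Proof.
move=> euv Cu [s ps lsr]; exists (move C u v :: s) => //=.
rewrite ps andbT; apply/existsP; exists u; apply/existsP; exists v.
by rewrite euv Cu /=.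
Qed.

Lemma weight_strategy_solvable w C :
  weight_strategy w -> \sum_v w v < weight w C -> root_solvable e r C.
Proof.
move=> wP; have [n] := ubnP (config_size C).
elim: n C => // n IHn C sizeC wC.
have /existsP[v /andP[wv Cv]] : [exists v, (0 < w v) && (1 < C v)].
  (* Otherwise vertices of positive weight hold at most one pebble each, so [C] weighs at most as
     much as the all-ones configuration. *)
  apply: contraTT wC => /existsPn noC; rewrite -leqNgt; apply: leq_sum => v _.
  have := noC v; rewrite negb_and -eqn0Ngt -leqNgt => /orP[/eqP->|Cv].
    by rewrite muln0.
  by rewrite -[X in _ <= X]mul1n leq_mul.
have [u evu ru] := wP v wv; apply: (root_solvable_move evu Cv).
case/orP: ru => [/eqP->|wu].
  by apply: root_solvable_pebbled; rewrite ffunE eqxx addn1.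
(* For the constant weight 1, [weight_move] says that the size drops by one. *)
have := weight_move (fun=> 1) u Cv; rewrite !weight1 muln1 addn2 addn1 => -[sizeE].
apply: IHn; first by rewrite sizeE.
apply: leq_trans wC _.
by rewrite -(leq_add2r (2 * w v)) (weight_move w u Cv) leq_add2l.
Qed.

(** Averaging: if [C] outweighed the all-ones configuration for no [i], summing over [l] would bound
    [m * t] by the total weight. *)
Lemma weight_strategies_solvable (I : eqType) (l : seq I) (w : I -> V -> nat)
    m t :
  {in l, forall i, weight_strategy (w i)} ->
  (forall v, v != r -> m <= \sum_(i <- l) w i v) ->
  \sum_(i <- l) \sum_v w i v < m * t ->
  every_config_solvable e r t.
Proof.
move=> wP lowb totb C sizeC.
case: (posnP (C r)) => [Cr0|]; last exact: root_solvable_pebbled.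
have /hasP[i li wi] : has (fun i => \sum_v w i v < weight (w i) C) l.
  apply: contraTT totb => /hasPn noi; rewrite -leqNgt.
  have /leq_trans-> // : m * t <= \sum_(i <- l) weight (w i) C.
    rewrite exchange_big -sizeC big_distrr /=; apply: leq_sum => v _.
    rewrite -big_distrr mulnC leq_mul2l /=.
    (* At the root the term vanishes because [C r = 0]. *)
    by case: eqVneq (lowb v) => [->|_ ->] //; rewrite ?Cr0 ?orbT.
  rewrite big_seq [X in _ <= X]big_seq; apply: leq_sum => i /noi.
  by rewrite -leqNgt.
exact: weight_strategy_solvable (wP i li) wi.
Qed.

End WeightFunctions.

(** * Existence of pebbling numbers *)

Lemma ex_minimum (P : nat -> Prop) t :
  P t -> exists2 m, P m /\ (forall t', P t' -> m <= t') & m <= t.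
Proof.
elim/ltn_ind: t => t IHt Pt.
(* [P] need not be decidable, hence excluded middle. *)
have [[s [lst Ps]]|no] := classic (exists s, s < t /\ P s).
  by have [m mP lems] := IHt s lst Ps; exists m => //; exact: leq_trans lems (ltnW lst).
exists t => //; split=> // t' Pt'; rewrite leqNgt; apply/negP => lt't.
by case: no; exists t'.
Qed.

Lemma pebbling_number_le (V : finType) (e : rel V) t :
  (forall r, every_config_solvable e r t) ->
  exists2 k, is_pebbling_number e k & k <= t.
Proof.
move=> St.
have [f fP fle] := fin_all_exists2 (fun r => ex_minimum (St r)).
by exists (\max_r f r); [exists f | apply/bigmax_leqP => r _].
Qed.

(** * Permutations as lists *)

Section OneLine.
Variable n : nat.
Implicit Types (p q : 'S_n) (s : seq nat).

(** Lists of numbers let the finite checks run by computation. *)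
Definition one_line p : seq nat := [seq val (p i) | i <- enum 'I_n].

(** The default 0 is never read when [k.+1 < size s]. *)
Definition swap_adjacent s k : seq nat :=
  mkseq (fun j => nth 0 s (if j == k then k.+1 else if j == k.+1 then k else j))
        (size s).

Lemma size_one_line p : size (one_line p) = n.
Proof. by rewrite size_map size_enum_ord. Qed.

Lemma nth_one_line p (i : 'I_n) : nth 0 (one_line p) i = p i.
Proof. by rewrite (nth_map i) ?size_enum_ord // nth_ord_enum. Qed.

Lemma one_line_inj : injective one_line.
Proof.
move=> p q epq; apply/permP => i; apply: val_inj => /=.
by rewrite -!nth_one_line epq.
Qed.

Lemma one_line1 : one_line 1%g = iota 0 n.
Proof. by rewrite -val_enum_ord; apply: eq_map => i; rewrite perm1. Qed.

Lemma one_line_permutations p : one_line p \in permutations (iota 0 n).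
Proof.
rewrite mem_permutations -val_enum_ord /one_line (map_comp val) perm_map //.
apply: uniq_perm; first by rewrite map_inj_uniq ?enum_uniq //; apply: perm_inj.
  exact: enum_uniq.
move=> i; rewrite mem_enum inE; apply/mapP; exists (p^-1%g i).
  by rewrite mem_enum.
by rewrite permKV.
Qed.

Lemma sum_one_line (F : seq nat -> nat) :
  \sum_p F (one_line p) = \sum_(s <- permutations (iota 0 n)) F s.
Proof.
rewrite -(big_map one_line xpredT F); apply: perm_big.
have uniq1 : uniq (map one_line (index_enum 'S_n)).
  by rewrite map_inj_uniq ?index_enum_uniq //; apply: one_line_inj.
apply: uniq_perm => //; first exact: permutations_uniq.
(* Both lists are duplicate-free of length [n!], so one inclusion suffices. *)
apply: (uniq_min_size uniq1 _ _).2 => [_ /mapP[p _ ->]|].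
  exact: one_line_permutations.
rewrite size_permutations ?iota_uniq // size_iota size_map.
by rewrite -card_Sn cardT enumT.
Qed.

Lemma weak_bruhat_swap p k :
  k.+1 < n ->
  exists2 q, weak_bruhat p q & one_line q = swap_adjacent (one_line p) k.
Proof.
move=> ltkn; pose i := Ordinal (ltnW ltkn); pose j := Ordinal ltkn.
exists (tperm i j * p)%g.
  by apply/existsP; exists i; apply/existsP; exists j; rewrite !eqxx.
apply: (@eq_from_nth _ 0) => [|x]; rewrite size_one_line.
  by rewrite size_mkseq size_one_line.
move=> ltxn; rewrite nth_mkseq ?size_one_line //.
rewrite (nth_one_line _ (Ordinal ltxn)) permM; case: tpermP => [[->]|[->]|].
- by rewrite eqxx -(nth_one_line p j).
- by rewrite /= eqxx (gtn_eqF (ltnSn k)) -(nth_one_line p i).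
move=> /eqP/negbTE neqi /eqP/negbTE neqj.
rewrite -[x == k]/(Ordinal ltxn == i) -[x == k.+1]/(Ordinal ltxn == j).
by rewrite neqi neqj -nth_one_line.
Qed.

Lemma weak_bruhat_mulg p q g : weak_bruhat p q -> weak_bruhat (p * g)%g (q * g)%g.
Proof.
case/existsP=> i /existsP[j /andP[ij /eqP->]].
by apply/existsP; exists i; apply/existsP; exists j; rewrite ij mulgA eqxx.
Qed.

(** A computable form of [weight_strategy] with the identity as root. *)
Definition one_line_strategy (w : seq nat -> nat) : bool :=
  all (fun s => (w s == 0) ||
    has (fun k => let s' := swap_adjacent s k in
                  (s' == iota 0 n) || (2 * w s <= w s')) (iota 0 n.-1))
    (permutations (iota 0 n)).

(* Right translation by [r] is an automorphism of the graph that takes the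
   identity to [r]. *)
Lemma one_line_strategyP w (r : 'S_n) :
  one_line_strategy w ->
  weight_strategy (@weak_bruhat n) r (fun p => w (one_line (p * r^-1)%g)).
Proof.
move=> /allP wP p wp.
have /orP[/eqP w0|/hasP[k]] := wP _ (one_line_permutations (p * r^-1)%g).
  by rewrite w0 in wp.
rewrite mem_iota add0n /= ltn_predRL => /(weak_bruhat_swap (p * r^-1)%g).
move=> [q pq <-] wq; exists (q * r)%g.
  by have := weak_bruhat_mulg r pq; rewrite mulgKV.
rewrite mulgK; case/orP: wq => [/eqP|->]; last by rewrite orbT.
by rewrite -one_line1 => /one_line_inj->; rewrite mul1g eqxx.
Qed.

End OneLine.

(** * The six weights on [B4] *)

Definition table_weight (T : seq (seq nat * nat)) (s : seq nat) : nat :=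
  \sum_(x <- T | x.1 == s) x.2.

(** Two weights start at each neighbour of the identity. Those through 0213 start at 64, not 32,
    because they go one step past the antipode 3210, to 3120. *)
Definition B4_strategies : seq (seq (seq nat * nat)) :=
  [:: [:: ([:: 1; 0; 2; 3], 32); ([:: 1; 2; 0; 3], 16); ([:: 2; 1; 0; 3], 8);
          ([:: 2; 1; 3; 0], 4); ([:: 2; 3; 1; 0], 2); ([:: 3; 2; 1; 0], 1)];
      [:: ([:: 1; 0; 2; 3], 32); ([:: 1; 2; 0; 3], 16); ([:: 1; 2; 3; 0], 8);
          ([:: 1; 3; 2; 0], 4); ([:: 3; 1; 2; 0], 2); ([:: 3; 2; 1; 0], 1);
          ([:: 2; 1; 3; 0], 4); ([:: 2; 3; 1; 0], 2)];
      [:: ([:: 0; 1; 3; 2], 32); ([:: 1; 0; 3; 2], 16); ([:: 1; 3; 0; 2], 8);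
          ([:: 1; 3; 2; 0], 4); ([:: 3; 1; 2; 0], 2); ([:: 3; 2; 1; 0], 1);
          ([:: 3; 1; 0; 2], 4)];
      [:: ([:: 0; 1; 3; 2], 32); ([:: 0; 3; 1; 2], 16); ([:: 3; 0; 1; 2], 8);
          ([:: 3; 1; 0; 2], 4); ([:: 3; 1; 2; 0], 2); ([:: 3; 2; 1; 0], 1)];
      [:: ([:: 0; 2; 1; 3], 64); ([:: 2; 0; 1; 3], 32); ([:: 2; 0; 3; 1], 16);
          ([:: 2; 3; 0; 1], 8); ([:: 2; 3; 1; 0], 4); ([:: 3; 2; 1; 0], 2);
          ([:: 3; 2; 0; 1], 4); ([:: 3; 1; 2; 0], 1)];
      [:: ([:: 0; 2; 1; 3], 64); ([:: 0; 2; 3; 1], 32); ([:: 0; 3; 2; 1], 16);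
          ([:: 3; 0; 2; 1], 8); ([:: 3; 2; 0; 1], 4); ([:: 3; 2; 1; 0], 2);
          ([:: 3; 1; 2; 0], 1)]].

Lemma B4_strategies_ok :
  all (fun T => one_line_strategy 4 (table_weight T)) B4_strategies.
(* Big operators are locked; [unlock] lets them compute. *)
Proof. by rewrite /table_weight unlock; vm_compute. Qed.

Lemma B4_strategies_cover :
  all (fun s => (s == iota 0 4) ||
                (8 <= \sum_(T <- B4_strategies) table_weight T s))
    (permutations (iota 0 4)).
Proof. by rewrite /table_weight unlock; vm_compute. Qed.

Lemma B4_strategies_total :
  \sum_(T <- B4_strategies) \sum_(s <- permutations (iota 0 4))
    table_weight T s = 520.
Proof. by rewrite /table_weight unlock; vm_compute. Qed.

Lemma B4_every_config_solvable (r : 'S_4) : every_config_solvable B4 r 66.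
Proof.
apply: (@weight_strategies_solvable _ _ _ _ B4_strategies
  (fun T p => table_weight T (one_line (p * r^-1)%g)) 8).
- by move=> T /(allP B4_strategies_ok) /one_line_strategyP; apply.
- move=> p; have := allP B4_strategies_cover _ (one_line_permutations (p * r^-1)%g).
  case/orP=> // /eqP; rewrite -one_line1 => /one_line_inj/(canRL (mulgKV r)).
  by rewrite mul1g => ->; rewrite eqxx.
(* Right translation permutes the vertices, so the total is 520 for every [r], below
   [8 * 66 = 528]. *)
under eq_bigr => T _.
  rewrite (reindex_inj (mulIg r)) /=.
  under eq_bigr => p _ do rewrite mulgK.
  rewrite sum_one_line.
  over.
by rewrite B4_strategies_total.
Qed.

Theorem mainTheorem8 : exists2 k : nat, is_pebbling_number B4 k & k <= 66.
Proof. exact: pebbling_number_le B4_every_config_solvable. Qed.
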